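(* Let $m\in\mathbb N$ and suppose the non-empty finite sets $A_1,\dots,A_m\subset\mathbb N$ form an $m$-part non-inclusive sum-and-distance system. For $j\in\{1,\dots,m\}$ let \[\tilde A_j:=\tfrac12\max A_j+\tfrac12\bigl(A_j\cup(-A_j)\bigr)=\Bigl\{\tfrac{\max A_j-a}{2},\tfrac{\max A_j+a}{2}: a\in A_j\Bigr\}.\] Then $\tilde A_1,\dots,\tilde A_m$ form an $m$-part sum system in which every component set has even cardinality. Conversely, suppose $\tilde A_1,\dots,\tilde A_m\subset\mathbb N_0$ form an $m$-part sum system in which every component set has even cardinality. For each $j$, write the elements of $\tilde A_j$ as $0=\alpha_1<\alpha_2<\dots<\alpha_{2\nu_j}$ and let \[A_j:=\{\alpha_{\nu_j+k}-\alpha_{\nu_j+1-k}: k\in\{1,\dots,\nu_j\}\}.\] Then $A_1,\dots,A_m$ form an $m$-part non-inclusive sum-and-distance system.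
   Context: $\mathbb N=\{1,2,\dots\}$, $\mathbb N_0=\mathbb N\cup\{0\}$, and for $N\in\mathbb N$, $\langle N\rangle:=\{0,1,\dots,N-1\}$. For sets $A,B\subset\mathbb R$ and reals $a,b$: $A+B=\{x+y:x\in A,y\in B\}$, $aA+b=\{ax+b:x\in A\}$, $-A=\{-x:x\in A\}$; $|A|$ is cardinality. An $m$-part sum system is a collection of finite sets $A_1,\dots,A_m\subset\mathbb N_0$, each of cardinality at least 2, with $\sum_{k=1}^m A_k=\langle\prod_{k=1}^m|A_k|\rangle$. Finite sets $A_1,\dots,A_m\subset\mathbb N$ form an $m$-part non-inclusive sum-and-distance system if \[\sum_{j=1}^m\bigl(A_j\cup(-A_j)\bigr)=2\Bigl\langle 2^m\prod_{j=1}^m|A_j|\Bigr\rangle-2^m\prod_{j=1}^m|A_j|+1.\] *)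

(* Defs.v *)
From mathcomp Require Import all_boot all_order all_algebra.
From mathcomp Require Import finmap.
From mathcomp Require Import reals.

Set Implicit Arguments.
Unset Strict Implicit.
Unset Printing Implicit Defensive.

Import Order.TTheory GRing.Theory Num.Theory.
Local Open Scope fset_scope.
Local Open Scope ring_scope.

Section SumSystems.
Variable R : realType.
Implicit Types (A B : {fset R}) (m N i k : nat).

Definition addfs A B : {fset R} := [fset x + y | x in A, y in B].

Definition affine (a : R) A (b : R) : {fset R} := [fset a * x + b | x in A].

Definition oppfs A : {fset R} := [fset - x | x in A].

Definition sumfs m (A : 'I_m -> {fset R}) : {fset R} :=
  \big[addfs/[fset 0]]_(j < m) A j.

(* <N> = {0, 1, ..., N - 1} *)
Definition initial N : {fset R} := [fset n%:R | n in iota 0 N].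

Definition symmetrized A : {fset R} := A `|` oppfs A.

Definition increasing_enum A : seq R := sort <=%R A.

(* Numbered from 1, so that A = {alpha A 1 < ... < alpha A #|` A|}. *)
Definition alpha A i : R := nth 0 (increasing_enum A) i.-1.

(* The maximum of A when A is nonempty, 0 otherwise. *)
Definition maxfs A : R := last 0 (increasing_enum A).

Definition sum_system m (A : 'I_m -> {fset R}) : Prop :=
  [/\ forall j, {in A j, forall x, x \is a Num.nat},
      forall j, (2 <= #|` A j|)%N
    & sumfs A = initial (\prod_(j < m) #|` A j|)%N].

(* The component sets may be empty here; their elements are positive. *)
Definition noninclusive_sum_and_distance_system m (A : 'I_m -> {fset R}) : Prop :=
  let N := (2 ^ m * \prod_(j < m) #|` A j|)%N in
  (forall j, {in A j, forall x, x \is a Num.nat /\ 0 < x}) /\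
  sumfs (fun j => symmetrized (A j)) = affine 2 (initial N) (- N%:R + 1).

Definition tilde A : {fset R} :=
  affine (1 / 2) (symmetrized A) (1 / 2 * maxfs A).

(* With #|` A| = 2 nu: {alpha_(nu + k) - alpha_(nu + 1 - k) : 1 <= k <= nu}. *)
Definition central_differences A : {fset R} :=
  let nu := (#|` A| %/ 2)%N in
  [fset alpha A (nu + k) - alpha A (nu + 1 - k) | k in iota 1 nu].

End SumSystems.

(* Main.v *)
Require Import Defs.
From mathcomp Require Import all_boot all_order all_algebra all_field.
From mathcomp Require Import finmap.
From mathcomp Require Import reals.
From mathcomp Require Import zify lra.

Set Implicit Arguments.
Unset Strict Implicit.
Unset Printing Implicit Defensive.

Import Order.TTheory GRing.Theory Num.Theory.
Local Open Scope fset_scope.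
Local Open Scope ring_scope.

(** Writing [M_j = max A_j], the sets [tilde A_j] and [A_j ∪ -A_j] differ by the
    affine map [x ↦ (x + M_j) / 2], and the sum of the [M_j] is the largest element
    of the sumset; as each [tilde A_j] contains [0], it lies in the sumset and so
    consists of natural numbers.

    For the converse the point is that every component [B] of a sum system is
    invariant under [x ↦ max B - x].  The generating polynomials of the components
    multiply to [1 + X + ... + X^(N-1)], so each is a real polynomial whose roots
    are simple roots of unity, and such a polynomial, being monic with constant
    term 1, is palindromic.  Reflection turns the central differences, together
    with their opposites, into the set [2 B - max B]. *)

(** * Palindromic divisors of X^n - 1 *)

(** A root of unity has modulus 1, since its modulus is a nonnegative real whose n-th power is 1. *)
Lemma conj_unity_root (C : numClosedFieldType) (n : nat) (z : C) :
  (0 < n)%N -> z ^+ n = 1 -> z^* = z^-1.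
Proof.
move=> n0 zn; have z1 : `|z| = 1.
  by apply/eqP; rewrite -(@pexpr_eq1 _ _ n) // -normrX zn normr1.
by rewrite invC_norm z1 expr1n invr1 mul1r.
Qed.

(* The roots of p are simple and closed under conjugation, which on roots of
   unity is inversion; hence p divides its reciprocal polynomial. *)
Lemma palindromic_dvd_Xn_sub_1 (C : numClosedFieldType) (n : nat)
    (p : {poly C}) :
  (0 < n)%N -> p %| 'X^n - 1 -> map_poly Num.conj p = p ->
  p \is monic -> p`_0 = 1 ->
  forall i, (i < size p)%N -> p`_i = p`_((size p).-1 - i).
Proof.
move=> n0 pdvd pC pmon p0 i ip.
(* The reciprocal polynomial of [p]; its leading coefficient is the constant term of [p], that is
   1. *)
set q := \poly_(i < size p) p`_((size p).-1 - i).
have sp : (0 < size p)%N by rewrite size_poly_gt0 monic_neq0.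
have qtop : p`_((size p).-1 - (size p).-1) = 1 by rewrite subnn.
have szq : size q = size p by rewrite size_poly_eq // qtop oner_eq0.
have qmon : lead_coef q = 1 by rewrite lead_coef_poly ?qtop ?oner_eq0.
suff pq : p = q by rewrite {1}pq coef_poly ip.
have [r pr] := closed_field_poly_normal p.
rewrite (monicP pmon) scale1r in pr.
(* In characteristic zero X^n - 1 is separable, and so is its divisor [p]. *)
have ur : uniq r.
  rewrite -separable_prod_XsubC -pr (dvdp_separable pdvd) //.
  by apply: separable_Xn_sub_1; rewrite pnatr_eq0 -lt0n.
have rootq z : z \in r -> root q z.
  move=> zr; have pz : root p z by rewrite pr root_prod_XsubC.
  have zn : z ^+ n = 1.
    apply/eqP; rewrite -subr_eq0; have := dvdp_trans _ pdvd.
    move/(_ ('X - z%:P)); rewrite !dvdp_XsubCl => /(_ pz) /rootP.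
    by rewrite !hornerE => ->.
  have z0 : z != 0.
    by apply: contra_eqN zn => /eqP ->; rewrite expr0n gtn_eqF // eq_sym oner_neq0.
  have : root p z^-1.
    rewrite -(conj_unity_root n0 zn) -pC; apply/rootP.
    by rewrite horner_map (rootP pz) rmorph0.
  move=> /rootP pV; apply/rootP.
  (* Reversing the order of summation gives q(z) = z^(deg p) p(1/z). *)
  have -> : q.[z] = z ^+ (size p).-1 * p.[z^-1]; last by rewrite pV mulr0.
  rewrite horner_poly horner_coef mulr_sumr (reindex_inj rev_ord_inj) /=.
  move: (size p) => s; apply: eq_bigr => -[k ks] _ /=.
  have -> : (s.-1 - (s - k.+1) = k)%N by lia.
  have -> : (s.-1 = (s - k.+1) + k)%N by lia.
  by rewrite exprD exprVn mulrCA mulfK // expf_neq0.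
(* The distinct roots of [p] are roots of [q], so [p] divides [q]; equal sizes make them associates,
   and leading coefficients 1 make them equal. *)
have /eqp_eq : p %= q.
  rewrite -dvdp_size_eqp ?szq // pr uniq_roots_dvdp ?uniq_rootsE //.
  exact/allP.
by rewrite qmon (monicP pmon) !scale1r.
Qed.

(** * Sumsets, affine images and symmetrization *)

Section Sumsets.
Variable R : realType.
Implicit Types (A B : {fset R}) (m N : nat).

Lemma mem_addfsP A B x :
  reflect (exists2 a, a \in A & exists2 b, b \in B & x = a + b)
          (x \in addfs A B).
Proof. exact: imfset2P. Qed.

Lemma mem_affineP c A b x :
  reflect (exists2 a, a \in A & x = c * a + b) (x \in affine c A b).
Proof. exact: imfsetP. Qed.

Lemma mem_initialP N x :
  reflect (exists2 n, (n < N)%N & x = n%:R) (x \in initial R N).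
Proof.
by apply: (iffP (imfsetP _ _ _ _)) => -[n] /=; rewrite ?mem_iota => nN ->;
  exists n => //=; rewrite mem_iota.
Qed.

Lemma mem_symmetrized A x : (x \in symmetrized A) = (x \in A) || (- x \in A).
Proof.
rewrite in_fsetU; congr orb; apply/imfsetP/idP => /= [[y yA ->]|xA].
  by rewrite opprK.
by exists (- x); rewrite ?opprK.
Qed.

Lemma mem_sumfsP m (A : 'I_m -> {fset R}) x :
  x \in sumfs A <->
  exists2 f : 'I_m -> R, (forall j, f j \in A j) & x = \sum_j f j.
Proof.
rewrite /sumfs; elim: m A x => [|m IH] A x.
  rewrite big_ord0 in_fset1; split=> [/eqP ->|[f _ ->]]; last by rewrite big_ord0.
  by exists (fun=> 0) => [[]|] //; rewrite big_ord0.
rewrite big_ord_recl; split.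
  move=> /mem_addfsP [a aA [b /IH [f fA ->] ->]].
  exists (fun i => if unlift ord0 i is Some j then f j else a).
    by move=> i; case: unliftP => [j|] ->.
  rewrite big_ord_recl unlift_none; congr (_ + _).
  by apply: eq_bigr => i _; rewrite liftK.
move=> [f fA ->]; apply/mem_addfsP; exists (f ord0) => //.
exists (\sum_(i < m) f (lift ord0 i)); last by rewrite big_ord_recl.
by apply/IH; exists (fun i => f (lift ord0 i)).
Qed.

Lemma sub_sumfs m (A : 'I_m -> {fset R}) j :
  (forall i, 0 \in A i) -> {subset A j <= sumfs A}.
Proof.
move=> A0 x xA; apply/mem_sumfsP.
(* Take [x] from the component [j] and 0 from every other one. *)
exists (fun i => if i == j then x else 0) => [i|].
  by case: eqP => [->|].
by rewrite -big_mkcond big_pred1_eq.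
Qed.

Lemma sumfs_affine m (A : 'I_m -> {fset R}) c (b : 'I_m -> R) :
  sumfs (fun j => affine c (A j) (b j)) = affine c (sumfs A) (\sum_j b j).
Proof.
rewrite /sumfs; elim/big_rec3: _ => [|j t S S' _ ->].
  apply/fsetP => x; rewrite in_fset1; apply/eqP/mem_affineP => [->|[a]].
    by exists 0; rewrite ?in_fset1 // mulr0 addr0.
  by rewrite in_fset1 => /eqP -> ->; rewrite mulr0 addr0.
apply/fsetP => x; apply/mem_addfsP/mem_affineP.
  move=> [_ /mem_affineP[u uA ->] [_ /mem_affineP[v vS ->] ->]].
  exists (u + v); last by rewrite mulrDr addrACA.
  by apply/mem_addfsP; exists u => //; exists v.
move=> [_ /mem_addfsP[u uA [v vS ->]] ->].
exists (c * u + b j); first by apply/mem_affineP; exists u.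
exists (c * v + t); last by rewrite mulrDr addrACA.
by apply/mem_affineP; exists v.
Qed.

Lemma affine_comp c d A b e :
  affine c (affine d A b) e = affine (c * d) A (c * b + e).
Proof.
apply/fsetP => x; apply/mem_affineP/mem_affineP.
  by move=> [_ /mem_affineP[a aA ->] ->]; exists a; rewrite // mulrDr mulrA addrA.
move=> [a aA ->]; exists (d * a + b); first by apply/mem_affineP; exists a.
by rewrite mulrDr mulrA addrA.
Qed.

Lemma affine1_0 A : affine 1 A 0 = A.
Proof.
apply/fsetP => x; apply/mem_affineP/idP => [[a aA ->]|xA].
  by rewrite mul1r addr0.
by exists x; rewrite // mul1r addr0.
Qed.

Lemma card_affine c A b : c != 0 -> #|` affine c A b| = #|` A|.
Proof.
by move=> c0; rewrite card_imfset //= => x y /addIr; apply: mulfI.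
Qed.

Lemma card_symmetrized A :
  {in A, forall x, 0 < x} -> #|` symmetrized A| = (#|` A|).*2.
Proof.
move=> Apos; rewrite cardfsU card_imfset //=; last exact: oppr_inj.
have -> : A `&` oppfs A = fset0.
  apply/fsetP => x; rewrite in_fsetI in_fset0; apply/negP => /andP[xA].
  by move/imfsetP => [y /= yA xy]; have := Apos _ xA; have := Apos _ yA; lra.
by rewrite cardfs0 subn0 addnn.
Qed.

(** * Increasing enumerations and maxima *)

Lemma mem_increasing_enum A : increasing_enum A =i A.
Proof. by move=> x; rewrite mem_sort. Qed.

Lemma size_increasing_enum A : size (increasing_enum A) = #|` A|.
Proof. exact: size_sort. Qed.

Lemma increasing_enum_sorted A : sorted <%R (increasing_enum A).
Proof. by rewrite sort_lt_sorted fset_uniq. Qed.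

Lemma maxfs_in A : A != fset0 -> maxfs A \in A.
Proof.
rewrite -cardfs_gt0 -size_increasing_enum -mem_increasing_enum /maxfs.
by case: (increasing_enum A) => //= a s _; apply: mem_last.
Qed.

Lemma maxfs_ge A : {in A, forall x, x <= maxfs A}.
Proof.
move=> x; rewrite -mem_increasing_enum => /(nthP 0)[i isz <-].
have sz := leq_ltn_trans (leq0n i) isz.
rewrite /maxfs -nth_last (lt_sorted_leq_nth 0 (increasing_enum_sorted A)) ?inE //.
  by rewrite -ltnS prednK.
by rewrite ltn_predL.
Qed.

(** The sum of the [M j] is itself attained, hence at most [t]; and [t], being a sum of elements, is
    bounded termwise by the [M j]. *)
Lemma sum_maxima m (A : 'I_m -> {fset R}) (M : 'I_m -> R) t :
  (forall j, M j \in A j) -> (forall j, {in A j, forall x, x <= M j}) ->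
  t \in sumfs A -> {in sumfs A, forall x, x <= t} -> \sum_j M j = t.
Proof.
move=> MA Mub tS tub; apply/eqP; rewrite eq_le; apply/andP; split.
  by apply: tub; apply/mem_sumfsP; exists M.
move/mem_sumfsP: tS => [f fA ->]; apply: ler_sum => j _; exact: Mub.
Qed.

Lemma initial_pred_in N : (0 < N)%N -> N%:R - 1 \in initial R N.
Proof.
move=> N0; apply/mem_initialP; exists N.-1; first lia.
by rewrite -subn1 natrB.
Qed.

Lemma initial_le_pred N : {in initial R N, forall x, x <= N%:R - 1}.
Proof.
move=> _ /mem_initialP[n nN ->]; by rewrite lerBrDr natr1 ler_nat.
Qed.

(** * Sums with multiplicity and generating polynomials *)

(* The same sums as in [sumfs], but listed with multiplicity. *)
Definition sumseq m (A : 'I_m -> {fset R}) : seq R :=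
  \big[(fun s t => [seq x + y | x <- s, y <- t])/[:: 0]]_(j < m) (A j : seq R).

Lemma mem_sumseq m (A : 'I_m -> {fset R}) : sumseq A =i sumfs A.
Proof.
rewrite /sumseq /sumfs; elim/big_rec2: _ => [x|j S s _ IH x].
  by rewrite inE in_fset1.
apply/allpairsP/mem_addfsP.
  by move=> [[a b] /= [aA bs ->]]; exists a => //; exists b; rewrite // -IH.
by move=> [a aA [b bS ->]]; exists (a, b); rewrite /= IH.
Qed.

Lemma size_sumseq m (A : 'I_m -> {fset R}) :
  size (sumseq A) = (\prod_(j < m) #|` A j|)%N.
Proof.
rewrite /sumseq; elim/big_rec2: _ => [|j k s _ <-] //.
by rewrite size_allpairs.
Qed.

(** Truncation is exact on the natural numbers to which this is applied. Coefficients lie in [algC]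
    so that polynomials split and conjugation is available. *)
Definition genpoly (s : seq R) : {poly algC} := \sum_(a <- s) 'X^(Num.truncn a).

Lemma conj_genpoly s : map_poly Num.conj (genpoly s) = genpoly s.
Proof.
by rewrite rmorph_sum; apply: eq_bigr => a _; apply: map_polyXn.
Qed.

Lemma genpoly_sumseq m (A : 'I_m -> {fset R}) :
  (forall j, {in A j, forall x, x \is a Num.nat}) ->
  genpoly (sumseq A) = \prod_(j < m) genpoly (A j).
Proof.
move=> Anat; suff [] : {in sumseq A, forall x, x \is a Num.nat} /\
    genpoly (sumseq A) = \prod_(j < m) genpoly (A j) by [].
rewrite /sumseq; elim/big_rec2: _ => [|j p s _ [snat <-]].
  split=> [x|]; first by rewrite inE => /eqP ->; exact: rpred0.
  by rewrite /genpoly big_seq1 truncn0.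
split.
  by move=> x /allpairsP[[a b] /= [/Anat an /snat bn ->]]; rewrite rpredD.
rewrite /genpoly big_allpairs_dep /= big_distrl /= [LHS]big_seq [RHS]big_seq.
apply: eq_bigr => a aA; rewrite big_distrr /= [LHS]big_seq [RHS]big_seq.
apply: eq_bigr => b bs; rewrite truncnD ?exprD ?(Anat j) //.
by rewrite qualifE /= natr_ge0 // snat.
Qed.

(** A finite set lists each element once, so every coefficient is 0 or 1, and none survives beyond
    the maximum. *)
Lemma genpolyE A :
  A != fset0 -> {in A, forall x, x \is a Num.nat} ->
  genpoly A = \poly_(i < (Num.truncn (maxfs A)).+1) ((i%:R : R) \in A)%:R.
Proof.
move=> A0 Anat; apply/polyP => i; rewrite coef_sum coef_poly.
have -> : \sum_(a <- A) ('X^(Num.truncn a) : {poly algC})`_i =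
    ((i%:R : R) \in A)%:R.
  have [iA|iA] := boolP (_ \in A).
    rewrite (big_fsetD1 i%:R) //= coefXn natrK eqxx big_seq big1 ?addr0 //.
    move=> a; rewrite !inE => /andP[ai aA]; rewrite coefXn.
    case: eqP => // ia; rewrite ia truncnK ?eqxx // in ai; exact: Anat.
  rewrite big_seq big1 // => a aA; rewrite coefXn.
  by case: eqP => // ia; rewrite ia truncnK ?aA // in iA; exact: Anat.
case: ltnP => // Mi; case: (boolP (_ \in A)) => // /maxfs_ge.
by rewrite -[maxfs A]truncnK ?Anat ?maxfs_in // ler_nat leqNgt Mi.
Qed.

(** * Components of a sum system and their reflection symmetry *)

Section SumSystem.
Variables (m : nat) (A : 'I_m -> {fset R}).
Hypothesis sysA : sum_system A.

Lemma sum_system_neq0 j : A j != fset0.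
Proof. by case: sysA => _ /(_ j) c2 _; rewrite -cardfs_gt0 ltnW. Qed.

Lemma sum_system_order_gt0 : (0 < \prod_(j < m) #|` A j|)%N.
Proof. by apply: prodn_gt0 => j; rewrite cardfs_gt0 sum_system_neq0. Qed.

(** The value 0 is a sum of nonnegative terms, one from each component, so all these terms
    vanish. *)
Lemma sum_system_0 j : 0 \in A j.
Proof.
case: sysA => Anat _ AS.
have /mem_sumfsP[f fA /esym/eqP] : 0 \in sumfs A.
  by rewrite AS; apply/mem_initialP; exists 0%N; rewrite ?sum_system_order_gt0.
rewrite psumr_eq0 => [/allP/(_ j)|i _]; last exact/natr_ge0/(Anat i).
by rewrite mem_index_enum => /(_ isT)/eqP <-.
Qed.

(* The number of sums equals the size of the interval they fill, so each value
   is attained exactly once. *)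
Lemma sum_system_genpoly :
  \prod_(j < m) genpoly (A j) =
  \sum_(i < \prod_(j < m) #|` A j|) ('X ^+ i : {poly algC}).
Proof.
case: sysA => Anat _ AS; rewrite -genpoly_sumseq //.
set N := (\prod_(j < m) _)%N in AS *.
set s := [seq n%:R : R | n <- iota 0 N].
have us : uniq s by rewrite map_inj_uniq ?iota_uniq //; apply: mulrIn; exact: oner_neq0.
have sS : s =i sumseq A.
  move=> x; rewrite mem_sumseq AS; apply/mapP/mem_initialP => -[n];
    by rewrite ?mem_iota => nN ->; exists n; rewrite ?mem_iota.
have uS : uniq (sumseq A).
  by rewrite (uniq_size_uniq us sS) size_sumseq size_map size_iota.
rewrite /genpoly (perm_big s); last by rewrite uniq_perm // => x; rewrite sS.
rewrite big_map -{1}[N]subn0 big_mkord.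
by apply: eq_bigr => i _; rewrite natrK.
Qed.

(** The coefficient of [genpoly (A j)] at i records whether i lies in [A j], so palindromicity of
    the polynomial is reflection symmetry of the set. *)
Lemma sum_system_reflect j x : x \in A j -> maxfs (A j) - x \in A j.
Proof.
move=> xA; have [Anat _ _] := sysA.
have A0 := sum_system_neq0 j; have MA := maxfs_in A0.
have defM := truncnK (Anat j _ MA); have defx := truncnK (Anat j _ xA).
have defP := genpolyE A0 (Anat j).
set M := Num.truncn (maxfs _) in defM defP.
have topP : ((M%:R : R) \in A j)%:R = 1 :> algC by rewrite defM MA.
have sP : size (genpoly (A j)) = M.+1.
  by rewrite defP size_poly_eq //= topP oner_eq0.
have coefP i : (i <= M)%N -> (genpoly (A j))`_i = ((i%:R : R) \in A j)%:R.
  by move=> iM; rewrite defP coef_poly ltnS iM.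
have xM : (Num.truncn x <= M)%N by rewrite -(ler_nat R) defM defx maxfs_ge.
have pal : (genpoly (A j))`_(Num.truncn x) =
    (genpoly (A j))`_((size (genpoly (A j))).-1 - Num.truncn x).
  apply: (palindromic_dvd_Xn_sub_1 sum_system_order_gt0).
  (* With N the product of the cardinalities, X^N - 1 is X - 1 times the product of all the
     generating polynomials. *)
  - by rewrite subrX1 -sum_system_genpoly (bigD1 j) //= dvdp_mull // dvdp_mulr.
  - exact: conj_genpoly.
  - by rewrite monicE lead_coefE sP coefP // topP.
  - by rewrite coefP // sum_system_0.
  - by rewrite sP ltnS.
(* The coefficient at [x] is 1, so the one at the reflected exponent cannot be 0. *)
move: pal; rewrite sP /= !coefP ?leq_subr // defx xA natrB // defM defx.
by case: (_ \in _) => // /eqP; rewrite oner_eq0.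
Qed.

Lemma sum_system_sum_maxfs :
  \sum_j maxfs (A j) = (\prod_(j < m) #|` A j|)%:R - 1.
Proof.
case: sysA => _ _ AS; apply: (@sum_maxima _ A) => [j|j||]; rewrite ?AS.
- exact/maxfs_in/sum_system_neq0.
- exact: maxfs_ge.
- exact/initial_pred_in/sum_system_order_gt0.
- exact: initial_le_pred.
Qed.

End SumSystem.

(** * Central differences of a reflection-symmetric set *)

Section Reflection.
Variable A : {fset R}.
Hypothesis reflA : {in A, forall x, maxfs A - x \in A}.
Let s := increasing_enum A.

(** Reflection reverses order and preserves [A], so the reversed list of reflected elements is again
    the strictly increasing enumeration of [A], which is unique. *)
Lemma nth_increasing_enum_reflect i :
  (i < #|` A|)%N -> nth 0 s (#|` A| - i.+1) = maxfs A - nth 0 s i.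
Proof.
rewrite -size_increasing_enum -/s => iA.
pose t := rev [seq maxfs A - x | x <- s].
suff st : s = t.
  have jA : (size s - i.+1 < size s)%N by move: (size s) iA => n; lia.
  have E : (size s - (size s - i.+1).+1 = i)%N by move: (size s) iA => n; lia.
  by rewrite {1}st nth_rev size_map // E (nth_map 0).
apply: lt_sorted_eq; first exact: increasing_enum_sorted.
  rewrite rev_sorted sorted_map; apply: sub_sorted (increasing_enum_sorted A).
  by move=> x y /= xy; rewrite ltrD2l ltrN2.
move=> x; rewrite mem_rev mem_increasing_enum; apply/idP/mapP => [xA|[y]].
  exists (maxfs A - x); first by rewrite mem_increasing_enum reflA.
  by rewrite opprB addrC subrK.
by rewrite mem_increasing_enum => yA ->; apply: reflA.
Qed.

Lemma alpha1_reflect : A != fset0 -> alpha A 1 = 0.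
Proof.
rewrite -cardfs_gt0 => A0; rewrite /alpha /=.
have lastA : ((#|` A|).-1 < #|` A|)%N by rewrite ltn_predL.
have := nth_increasing_enum_reflect lastA.
by rewrite prednK // subnn => ->; rewrite -size_increasing_enum nth_last subrr.
Qed.

Hypothesis evenA : ~~ odd #|` A|.

(** Counted from 0, the index is i = nu + k - 1, and nu + 1 - k becomes the mirror index |A| - 1 - i
    because |A| = 2 nu. *)
Lemma mem_central_differencesP x :
  reflect (exists2 i, (#|` A| %/ 2 <= i < #|` A|)%N &
             x = nth 0 s i - nth 0 s (#|` A| - i.+1))
          (x \in central_differences A).
Proof.
have ev := evenA; rewrite /central_differences; set n := #|` A| in ev *.
have nE : n = ((n %/ 2) * 2)%N by move: ev; lia.
apply: (iffP (imfsetP _ _ _ _)) => /=.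
  move=> [k]; rewrite mem_iota => kn ->; exists (n %/ 2 + k).-1; first by lia.
  by rewrite /alpha; congr (nth _ _ _ - nth _ _ _); lia.
move=> [i iA ->]; exists (i - n %/ 2).+1; first by rewrite mem_iota; lia.
by rewrite /alpha; congr (nth _ _ _ - nth _ _ _); lia.
Qed.

Lemma central_differences_gt0 : {in central_differences A, forall x, 0 < x}.
Proof.
move=> _ /mem_central_differencesP[i iA ->]; rewrite subr_gt0.
have := lt_sorted_ltn_nth 0 (increasing_enum_sorted A) => ->;
  rewrite ?inE ?size_increasing_enum; move: (#|` A|) (evenA) iA => n; lia.
Qed.

Lemma central_differences_nat :
  {in A, forall x, x \is a Num.nat} ->
  {in central_differences A, forall x, x \is a Num.nat}.
Proof.
(* Positivity is recorded first: a difference of naturals is natural only when it is nonnegative. *)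
move=> Anat x xD; have := central_differences_gt0 xD.
case/mem_central_differencesP: xD => i iA -> {x}.
have snat k : (k < #|` A|)%N -> nth 0 s k \is a Num.nat.
  move=> kA; apply: Anat; rewrite -mem_increasing_enum mem_nth //.
  by rewrite size_increasing_enum.
have /natrP[a ->] : nth 0 s i \is a Num.nat by apply: snat; case/andP: iA.
have /natrP[b ->] : nth 0 s (#|` A| - i.+1) \is a Num.nat.
  by apply: snat; move: (#|` A|) iA => n; lia.
by rewrite subr_gt0 ltr_nat => ba; rewrite -natrB ?natr_nat // ltnW.
Qed.

(** Reflection turns the difference at index i into twice the i-th element minus the maximum; the
    upper half of the indices yields the central differences, the lower half their opposites. *)
Lemma symmetrized_central_differences :
  symmetrized (central_differences A) = affine 2 A (- maxfs A).
Proof.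
have D i : (i < #|` A|)%N ->
    nth 0 s i - nth 0 s (#|` A| - i.+1) = 2 * nth 0 s i - maxfs A.
  by move=> iA; rewrite nth_increasing_enum_reflect //; lra.
have sA i : (i < #|` A|)%N -> nth 0 s i \in A.
  by move=> iA; rewrite -mem_increasing_enum mem_nth // size_increasing_enum.
apply/fsetP => x; rewrite mem_symmetrized; apply/orP/mem_affineP.
  move=> [] /mem_central_differencesP[i /andP[_ iA]]; rewrite D // => xE.
    by exists (nth 0 s i); rewrite ?sA.
  (* If -x = 2a - M, then x = 2(M - a) - M. *)
  by exists (maxfs A - nth 0 s i); [exact/reflA/sA | lra].
move=> [a]; rewrite -mem_increasing_enum => /(nthP 0)[i].
rewrite size_increasing_enum => iA <- ->; rewrite -D //.
case: (leqP (#|` A| %/ 2) i) => ni; [left|right].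
  by apply/mem_central_differencesP; exists i; rewrite ?ni.
apply/mem_central_differencesP; exists (#|` A| - i.+1)%N.
  by move: (#|` A|) iA ni (evenA) => n; lia.
rewrite opprB; congr (_ - nth _ _ _).
by move: (#|` A|) iA => n; lia.
Qed.

(** Positivity makes the symmetrization exactly double the size, and the symmetrization is an
    injective affine image of [A]. *)
Lemma card_central_differences : (2 * #|` central_differences A|)%N = #|` A|.
Proof.
rewrite mul2n -card_symmetrized; last exact: central_differences_gt0.
by rewrite symmetrized_central_differences card_affine // pnatr_eq0.
Qed.

End Reflection.

(** * The shifted and halved symmetrizations *)

Section Tilde.
Variable A : {fset R}.
Hypotheses (A0 : A != fset0) (Apos : {in A, forall x, 0 < x}).

Lemma symmetrized_le_maxfs : {in symmetrized A, forall x, x <= maxfs A}.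
Proof.
move=> x; rewrite mem_symmetrized => /orP[/maxfs_ge //|/Apos].
by have := Apos (maxfs_in A0); lra.
Qed.

Lemma tildeE :
  tilde A = [fset (maxfs A - a) / 2 | a in A] `|`
            [fset (maxfs A + a) / 2 | a in A].
Proof.
apply/fsetP => x; rewrite in_fsetU; apply/mem_affineP/orP.
  move=> [a]; rewrite mem_symmetrized => /orP[aA|aA] ->; [right|left];
    by apply/imfsetP => /=; eexists; [exact: aA | lra].
move=> [] /imfsetP[/= a aA ->]; [exists (- a)|exists a];
  by rewrite ?mem_symmetrized ?opprK ?aA ?orbT //; lra.
Qed.

Lemma tilde0 : 0 \in tilde A.
Proof.
apply/mem_affineP; exists (- maxfs A); last by lra.
by rewrite mem_symmetrized opprK maxfs_in ?orbT.
Qed.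

Lemma card_tilde : #|` tilde A| = (#|` A|).*2.
Proof.
rewrite card_affine ?card_symmetrized // mulf_eq0 oner_eq0 invr_eq0 /=.
by rewrite pnatr_eq0.
Qed.

End Tilde.

(** * From sum-and-distance systems to sum systems *)

Section SumAndDistance.
Variables (m : nat) (A : 'I_m -> {fset R}).
Hypotheses (A0 : forall j, A j != fset0)
  (sysA : noninclusive_sum_and_distance_system A).
Let N := (2 ^ m * \prod_(j < m) #|` A j|)%N.

Lemma noninclusive_gt0 j : {in A j, forall x, 0 < x}.
Proof. by case: sysA => Apos _ x /Apos[]. Qed.

Lemma noninclusive_sum_maxfs : \sum_j maxfs (A j) = N%:R - 1.
Proof.
have [_ AS] := sysA.
have N0 : (0 < N)%N.
  by rewrite muln_gt0 expn_gt0 /= prodn_gt0 // => j; rewrite cardfs_gt0.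
apply: (@sum_maxima _ (fun j => symmetrized (A j))) => [j|j||].
- by rewrite mem_symmetrized maxfs_in.
- exact/symmetrized_le_maxfs/noninclusive_gt0.
(* The largest element of the prescribed sumset is 2(N - 1) - N + 1 = N - 1. *)
- rewrite AS; apply/mem_affineP; exists (N%:R - 1); first exact: initial_pred_in.
  by rewrite -/N; lra.
- by rewrite AS => _ /mem_affineP[x /initial_le_pred xN ->]; rewrite -/N in xN *; lra.
Qed.

Lemma sum_system_tilde : sum_system (fun j => tilde (A j)).
Proof.
have [_ AS] := sysA; have Apos := noninclusive_gt0.
have card j : #|` tilde (A j)| = (#|` A j|).*2 by exact: card_tilde.
have cardN : (\prod_(j < m) #|` tilde (A j)|)%N = N.
  rewrite (eq_bigr (fun j => 2 * #|` A j|)%N) => [|j _]; last by rewrite mul2n.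
  by rewrite big_split /= prod_nat_const card_ord.
have tS : sumfs (fun j => tilde (A j)) = initial R N.
  (* The maps compose to the identity: (2x - N + 1)/2 + (N - 1)/2 = x. *)
  rewrite sumfs_affine AS affine_comp -/N -mulr_sumr noninclusive_sum_maxfs.
  by rewrite -[RHS]affine1_0; congr affine; lra.
split; last by rewrite cardN.
  move=> j x xA; have : x \in initial R N.
    by rewrite -tS; apply: sub_sumfs xA => i; apply: tilde0.
  by move=> /mem_initialP[n _ ->]; apply: natr_nat.
by move=> j; rewrite card (leq_double 1) cardfs_gt0.
Qed.

End SumAndDistance.

(** * From sum systems back to sum-and-distance systems *)

Lemma noninclusive_central_differences m (A : 'I_m -> {fset R}) :
  sum_system A -> (forall j, ~~ odd #|` A j|) ->
  noninclusive_sum_and_distance_system (fun j => central_differences (A j)).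
Proof.
move=> sysA evenA; have [Anat _ AS] := sysA.
have reflA j : {in A j, forall x, maxfs (A j) - x \in A j}.
  by move=> x; apply: sum_system_reflect.
rewrite /noninclusive_sum_and_distance_system.
(* Each of the m factors 2 compensates the halving of one component's cardinality. *)
have -> : (2 ^ m * \prod_(j < m) #|` central_differences (A j)| =
           \prod_(j < m) #|` A j|)%N.
  rewrite -{1}[m]card_ord -prod_nat_const -big_split /=.
  by apply: eq_bigr => j _; apply: card_central_differences.
split=> [j x xD|].
  split; first exact: central_differences_nat xD.
  exact: central_differences_gt0 xD.
have -> : sumfs (fun j => symmetrized (central_differences (A j))) =
          sumfs (fun j => affine 2 (A j) (- maxfs (A j))).
  by apply: eq_bigr => j _; apply: symmetrized_central_differences.
by rewrite sumfs_affine AS sumrN sum_system_sum_maxfs // opprB addrC.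
Qed.

End Sumsets.

Theorem theorem2 (R : realType) (m : nat) (hm : (0 < m)%N) :
  (forall A : 'I_m -> {fset R},
     (forall j, A j != fset0) ->
     noninclusive_sum_and_distance_system A ->
     [/\ forall j, tilde (A j) =
           [fset (maxfs (A j) - a) / 2 | a in A j] `|`
           [fset (maxfs (A j) + a) / 2 | a in A j],
         sum_system (fun j => tilde (A j))
       & forall j, ~~ odd #|` tilde (A j)|])
  /\
  (forall tA : 'I_m -> {fset R},
     sum_system tA ->
     (forall j, ~~ odd #|` tA j|) ->
     (forall j, alpha (tA j) 1 = 0) /\
     noninclusive_sum_and_distance_system (fun j => central_differences (tA j))).
Proof.
split=> [A A0 sysA|A sysA evenA]; split.
- by move=> j; apply: tildeE.
- exact: sum_system_tilde.
- by move=> j; rewrite card_tilde ?odd_double //; apply: noninclusive_gt0.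
- move=> j; apply: alpha1_reflect; last exact: sum_system_neq0.
  by move=> x; apply: sum_system_reflect.
- exact: noninclusive_central_differences.
Qed.
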